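(* Let $\Phi:\mathbb{R}^+\times\Omega\times X\to X$ be a Markovian random dynamical system over $\theta$. If $\Phi$ has an adapted random almost periodic solution $H:\mathbb{R}\times\Omega\to X$ with relatively dense set $\{\tau_k\}$, then it has an almost periodic probability measure $\lambda:\mathbb{R}\to\mathcal{P}(X)$, $t\mapsto\lambda_t$, on the phase space $(X,\mathcal{B}(X))$, given by: for any $g\in C_{BL}(X)$, $$\lambda_t(g)=\int_\Omega g(H(t,\theta_{-t}\omega))\,P(d\omega),$$ and for any $A\in\mathcal{B}(X)$, $$\lambda_t(A)=P(\{\omega:H(t,\theta_{-t}\omega)\in A\}).$$
   Context: $(\Omega,\mathcal{F},P)$ is a probability space and $\theta=(\theta_t)_{t\in\mathbb{R}}$ is a measure-preserving measurable flow on it: $\theta_0=\mathrm{Id}$, $\theta_{t+s}=\theta_t\circ\theta_s$, $(\omega,t)\mapsto\theta_t\omega$ is measurable, and each $\theta_t$ preserves $P$. $(X,d)$ is a Polish space with Borel $\sigma$-algebra $\mathcal{B}(X)$; $\mathbb{R}^+=[0,\infty)$ for time. A filtered dynamical system $(\Omega,\mathcal{F},P,(\theta_t)_{t\in\mathbb{R}},(\mathcal{F}^s_t)_{t\le s})$ carries in addition sub-$\sigma$-algebras $\mathcal{F}^s_t\subset\mathcal{F}$, $t\le s$, with $\mathcal{F}^s_t\subset\mathcal{F}^v_u$ for $u\le t\le s\le v$ and $\theta_r^{-1}\mathcal{F}^s_t=\mathcal{F}^{s+r}_{t+r}$ for all $r\in\mathbb{R}$. Put $\mathcal{F}^s_{-\infty}=\sigma(\bigcup_{t\le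 s}\mathcal{F}^s_t)$ and $\mathcal{F}^\infty_s=\sigma(\bigcup_{u\ge s}\mathcal{F}^u_s)$. A (measurable, one-sided time) random dynamical system over $\theta$ is a $(\mathcal{B}(\mathbb{R}^+)\otimes\mathcal{F}\otimes\mathcal{B}(X),\mathcal{B}(X))$-measurable map $\Phi:\mathbb{R}^+\times\Omega\times X\to X$ with $\Phi(0,\omega)=\mathrm{id}_X$ and $\Phi(t+s,\omega)=\Phi(t,\theta_s\omega)\circ\Phi(s,\omega)$ for all $s,t\in\mathbb{R}^+$, $\omega\in\Omega$. It is Markovian if, over a filtered dynamical system, $\Phi(t,\cdot)x$ is $\mathcal{F}^t_0$-measurable for all $t\ge0$, $x\in X$, and $\mathcal{F}^s_{-\infty}$ and $\mathcal{F}^\infty_s$ are independent for each $s\in\mathbb{R}$ (so that $\Phi(t,\theta_s\cdot)$ is independent of $\mathcal{F}^s_{-\infty}$). Its transition probability is $P(t,x,B)=P(\{\omega:\Phi(t,\omega)x\in B\})$, and for $\lambda\in\mathcal{P}(X)$, $P_t^*\lambda(B)=\int_XP(t,x,B)\,\lambda(dx)$, $t\ge0$, $B\in\mathcal{B}(X)$. A set $E\subset\mathbb{R}$ is relatively dense if there is $l>0$ such that every interval $[a,a+l]$, $a\in\mathbb{R}$, contains a point of $E$; a number $l(\varepsilon)$ defines a relatively dense set $\{\tau_k\}$ if this holds with $l=l(\varepsilon)$. A random almost periodic solution of $\Phi$ is an $\mathcal{F}$-measurable map $H:\mathbb{R}\times\Omega\to X$ (i.e. $\omega\mapsto H(t,\omega)$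 is $\mathcal{F}$-measurable for each $t$) such that for any $\varepsilon>0$ there is a number $l(\varepsilon)$ defining a relatively dense set of numbers $\{\tau_k\}$ (depending on $\varepsilon$) such that for almost all $\omega\in\Omega$, $$\Phi(t,\theta_s\omega)H(s,\omega)=H(t+s,\omega),\qquad d(H(s+\tau_k,\omega),H(s,\theta_{\tau_k}\omega))<\varepsilon,\qquad\forall t\in\mathbb{R}^+,\ s\in\mathbb{R},\ \forall k.$$ It is adapted if $H(s,\cdot)$ is $\mathcal{F}^s_{-\infty}$-measurable for every $s\in\mathbb{R}$. $\mathcal{P}(X)$ is the set of probability measures on $(X,\mathcal{B}(X))$. Fix a constant $C_2\in\mathbb{R}^+$; $C_{BL}(X)$ is the set of continuous $g:X\to\mathbb{R}$ with finite norm $\|g\|=\sup_{x\in X}|g(x)|$ and $|g(x)-g(y)|\le C_2d(x,y)$ for all $x,y\in X$. $\mathcal{P}(X)$ is endowed with $$\rho_1(\mu,\nu)=\sup\{|\mu(g)-\nu(g)|:g\in C_{BL}(X),\ \|g\|\le1\},$$ where $\mu(g)=\int g\,d\mu$. A map $\lambda:\mathbb{R}\to\mathcal{P}(X)$, $t\mapsto\lambda_t$, is called an almost periodic probability measure on the phase space $(X,\mathcal{B}(X))$ if for any $\varepsilon>0$ there exists a number $l(\varepsilon)$ defining a relatively dense set of numbers $\{\tau_k\}$ such that $$P_t^*\lambda_s=\lambda_{t+s},\qquad\rho_1(\lambda_{\tau_k+s},\lambda_s)<\varepsilon,\qquad\forall t\in\mathbb{R}^+,\ s\in\mathbb{R},\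 \forall k.$$
   Formalization: ''Markovian'' here also requires that (ω,x) ↦ Φ(t,θ_sω)x be jointly measurable over A⊗B(X) for some σ-algebra A independent of F^s_{-∞}; this is automatic if Φ is continuous in x, and without it the claim fails for some merely measurable Φ. *)

(* Defs.v *)
From HB Require Import structures.
From mathcomp Require Import all_boot all_order all_algebra.
From mathcomp Require Import all_classical all_reals all_analysis.

Set Implicit Arguments.
Unset Strict Implicit.
Unset Printing Implicit Defensive.
Import Order.TTheory GRing.Theory Num.Theory.
Import numFieldNormedType.Exports.
Local Open Scope classical_set_scope.
Local Open Scope ring_scope.

(* A point is needed for the library's Borel measurable structure; the spaces
   considered below are nonempty anyway, being the target of a random
   variable. *)
#[short(type="completePMetricType")]
HB.structure Definition CompletePMetric (K : numDomainType) :=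
  {T of Metric K T & Uniform_isComplete T & isPointed T}.

Definition separable (T : topologicalType) : Prop :=
  exists2 D : set T, countable D & dense D.

Notation borel X := (g_sigma_algebraType (@open X)).

(* [phi] is measurable from the sigma-algebra [G] to the Borel sets. *)
Definition sub_measurable (Om : Type) d (T : measurableType d)
    (G : set (set Om)) (phi : Om -> T) : Prop :=
  forall B, measurable B -> G (phi @^-1` B).

Section Flow.
Context (R : realType) (d : measure_display) (Om : measurableType d).
Variable (P : probability Om R).
Implicit Types (th : R -> Om -> Om) (Fi : R -> R -> set (set Om)).

Record metric_flow th : Prop := MetricFlow {
  flow_id : forall w, th 0 w = w ;
  flow_add : forall (t s : R) w, th (t + s) w = th t (th s w) ;
  flow_measurable :
    measurable_fun setT (fun p : Om * measurableTypeR R => th p.2 p.1) ;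
  flow_preserving : forall (t : R) A, measurable A -> P (th t @^-1` A) = P A }.

(* [Fi t s] stands for F_t^s and is only meaningful for t <= s. *)
Record filtered_flow th Fi : Prop := FilteredFlow {
  filtered_metric_flow : metric_flow th ;
  filtration_sigma : forall t s : R, t <= s -> sigma_algebra setT (Fi t s) ;
  filtration_sub : forall t s : R, t <= s -> Fi t s `<=` measurable ;
  filtration_mono : forall u t s v : R, u <= t -> t <= s -> s <= v ->
    Fi t s `<=` Fi u v ;
  filtration_shift : forall r t s : R, t <= s ->
    preimage_set_system setT (th r) (Fi t s) = Fi (t + r) (s + r) }.

Definition past Fi (s : R) : set (set Om) :=
  <<s \bigcup_(t in [set t | t <= s]) Fi t s >>.

Definition future Fi (s : R) : set (set Om) :=
  <<s \bigcup_(u in [set u | s <= u]) Fi s u >>.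

Definition indep_sigma (G1 G2 : set (set Om)) : Prop :=
  forall A B, G1 A -> G2 B -> P (A `&` B) = (P A * P B)%E.

End Flow.

Section RDS.
Context (R : realType) (d : measure_display) (Om : measurableType d).
Variable (P : probability Om R).
Context (X : completePMetricType R).
Implicit Types (th : R -> Om -> Om) (Fi : R -> R -> set (set Om)).
(* Times in R^+ are reals t with a hypothesis 0 <= t; values of [Phi] at
   negative times are irrelevant. *)
Implicit Types (Phi : R -> Om -> X -> X) (H : R -> Om -> X).

Record random_dynamical_system th Phi : Prop := RandomDynamicalSystem {
  rds_measurable : measurable_fun
    [set p : measurableTypeR R * Om * borel X | 0 <= (p.1.1 : R)]
    (fun p : measurableTypeR R * Om * borel X =>
       Phi p.1.1 p.1.2 p.2 : borel X) ;
  rds_id : forall w x, Phi 0 w x = x ;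
  rds_cocycle : forall (t s : R) w x, 0 <= t -> 0 <= s ->
    Phi (t + s) w x = Phi t (th s w) (Phi s w x) }.

(* Independence of the random map phi : Om -> (X -> X) and the sigma-algebra
   [G]: phi is a measurable random map over some sigma-algebra independent
   of [G]. *)
Definition random_map_indep (phi : Om -> X -> X) (G : set (set Om)) : Prop :=
  exists A : set (set Om),
    [/\ sigma_algebra setT A, A `<=` measurable, indep_sigma P A G &
        measurable_fun setT (fun p : g_sigma_algebraType A * borel X =>
          phi p.1 p.2 : borel X)].

(* The last clause spells out that Phi(t, theta_s .) is independent of
   F_{-oo}^s. When Phi(t, w) is continuous in x it follows from the others
   (take for A the preimage of F_0^t under theta_s, i.e. F_s^{t+s}). Without
   continuity, measurability of Phi(t, .)x for each fixed x does not give
   independence of the map as a whole, and the Markov property may fail. *)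
Record markovian th Fi Phi : Prop := Markovian {
  markov_filtered : filtered_flow P th Fi ;
  markov_adapted : forall (t : R) x, 0 <= t ->
    sub_measurable (Fi 0 t) (fun w => Phi t w x : borel X) ;
  markov_indep : forall s, indep_sigma P (past Fi s) (future Fi s) ;
  markov_map_indep : forall t s : R, 0 <= t ->
    random_map_indep (fun w => Phi t (th s w)) (past Fi s) }.

Definition transition Phi (t : R) (x : X) (B : set X) : \bar R :=
  P [set w | B (Phi t w x)].

Definition dual_transition Phi (t : R) (la : probability (borel X) R)
    (B : set X) : \bar R :=
  (\int[la]_x transition Phi t x B)%E.

Definition relatively_dense (E : set R) : Prop :=
  exists2 l : R, 0 < l & forall a : R, exists2 x, E x & a <= x <= a + l.

Record random_almost_periodic_solution th Phi H : Prop :=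
  RandomAlmostPeriodicSolution {
  raps_measurable : forall t, measurable_fun setT (H t : Om -> borel X) ;
  raps_almost_periodic : forall e : R, 0 < e ->
    exists2 E : set R, relatively_dense E &
      {ae P, forall w,
        (forall t s : R, 0 <= t -> Phi t (th s w) (H s w) = H (t + s) w) /\
        (forall tau s : R, E tau ->
          mdist (H (s + tau) w) (H s (th tau w)) < e)} }.

Definition adapted Fi H : Prop :=
  forall s, sub_measurable (past Fi s) (H s : Om -> borel X).

Definition supnorm (g : X -> R) : \bar R :=
  ereal_sup [set (`|g x|)%:E | x in [set: X]].

Definition CBL (C2 : R) : set (X -> R) :=
  [set g | [/\ continuous g, (supnorm g < +oo)%E &
     forall x y, `|g x - g y| <= C2 * mdist x y]].

Definition rho1 (C2 : R) (mu nu : probability (borel X) R) : \bar R :=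
  ereal_sup [set (`| \int[mu]_x (g x)%:E - \int[nu]_x (g x)%:E |)%E
            | g in [set g | CBL C2 g /\ (supnorm g <= 1)%E]].

Definition almost_periodic_probability_measure (C2 : R) Phi
    (la : R -> probability (borel X) R) : Prop :=
  forall e : R, 0 < e ->
    exists2 E : set R, relatively_dense E &
      (forall (t s : R) (B : set (borel X)), 0 <= t -> measurable B ->
        dual_transition Phi t (la s) B = la (t + s) B) /\
      (forall tau s : R, E tau -> (rho1 C2 (la (tau + s)%R) (la s) < e%:E)%E).

End RDS.

(* Main.v *)
Require Import Defs.
From HB Require Import structures.
From mathcomp Require Import all_boot all_order all_algebra.
From mathcomp Require Import all_classical all_reals all_analysis.
From mathcomp Require Import measurable_realfun.
Set Implicit Arguments.
Unset Strict Implicit.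
Unset Printing Implicit Defensive.
Import Order.TTheory GRing.Theory Num.Theory.
Import numFieldNormedType.Exports.
Local Open Scope classical_set_scope.
Local Open Scope ring_scope.

(** The measure lambda_t is the law of H(t, .); since theta_{-t} preserves P it
    is also the law of H(t, theta_{-t} .), which gives both formulas of the
    statement.

    Evolution.  By invariance of P, P(t, x, B) is also the probability that
    Phi(t, theta_s w) x lies in B.  The random map Phi(t, theta_s .) is
    independent of the past of s, and H(s, .) is measurable for that past; so
    the joint law of the random map and H(s, .) is a product, and Fubini's
    theorem turns the integral of P(t, x, B) against lambda_s into the
    probability that Phi(t, theta_s w) H(s, w) lies in B
    ([dual_transition_law]).  Almost surely that point is H(t + s, w), whose
    law is lambda_(t + s).

    Almost periodicity.  For any tau, lambda_s is the law of H(s, theta_tau .)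
    as well, so the two random variables H(s + tau, .) and H(s, theta_tau .)
    form a coupling of lambda_(tau + s) and lambda_s.  If they are almost
    surely delta-close, every C2-Lipschitz test function has integrals
    differing by at most C2 * delta ([rho1_law_le]).  Taking the almost periods
    of H for delta = e / (C2 + 1) gives rho_1 < e. *)

(** * Laws of random variables and independence *)

Section Law.
Context (R : realType) (d d' : measure_display).
Context (Om : measurableType d) (T : measurableType d').
Variables (P : probability Om R) (f : Om -> T).
Hypothesis mf : measurable_fun setT f.

(** The law is bundled as a probability from a bare measurability proof, so
    that it applies to the functions [H t] without packing them first. *)
Definition law : probability T R :=
  distribution P (mfun_Sub (mem_set mf) : {mfun Om >-> T}).

End Law.
Arguments law {R d d' Om T} P {f} mf.

Lemma ae_measure_eq (R : realType) d (Om : measurableType d)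
    (P : {measure set Om -> \bar R}) (A B : set Om) :
  measurable A -> measurable B -> {ae P, forall w, A w <-> B w} -> P A = P B.
Proof.
move=> mA mB AB.
rewrite -(setIT A) -(setIT B) -!integral_indic//.
apply: ae_eq_integral => //.
- exact/measurable_EFinP.
- exact/measurable_EFinP.
apply: filterS AB => w AB _ /=.
rewrite !indicE; congr (_%:R%:E); congr (nat_of_bool _).
by apply/idP/idP; rewrite !inE => /AB.
Qed.

(** The joint law of (f, g) agrees with the product of the two laws on
    rectangles, hence everywhere; the product measure is then computed by
    integrating over the second coordinate the measure of the sections. *)
Lemma law_pair_indep (R : realType) d d1 d2 (Om : measurableType d)
    (T1 : measurableType d1) (T2 : measurableType d2) (P : probability Om R)
    (f : Om -> T1) (g : Om -> T2)
    (mf : measurable_fun setT f) (mg : measurable_fun setT g) :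
  (forall A B, measurable A -> measurable B ->
    P (f @^-1` A `&` g @^-1` B) = P (f @^-1` A) * P (g @^-1` B))%E ->
  forall C : set (T1 * T2), measurable C ->
    P [set w | C (f w, g w)] =
    (\int[law P mg]_y P [set w | C (f w, y)])%E.
Proof.
move=> fg C mC.
have mfg := measurable_fun_pair mf mg.
have rect A B : measurable A -> measurable B ->
    (law P mfg (A `*` B) = law P mf A * law P mg B)%E.
  exact: fg.
transitivity (law P mfg C); first by [].
rewrite -(product_measure_unique rect mC).
have rect2 A B : measurable A -> measurable B ->
    ((law P mf \x^ law P mg) (A `*` B) = law P mf A * law P mg B)%E.
  by move=> mA mB; exact: product_measure2E.
rewrite (product_measure_unique rect2 mC).
rewrite /product_measure2; apply: eq_integral => y _.
rewrite /= /ysection /distribution/= /pushforward.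
by congr (P _); apply/seteqP; split => w /=; rewrite inE.
Qed.

(** * Integrability of the test functions *)

Lemma continuous_borel_measurable (R : realType) (X : completePMetricType R)
    (g : X -> R) :
  continuous g -> measurable_fun setT (g : borel X -> R).
Proof.
move=> /continuousP cg.
apply: (measurability _ (RGenOpens.measurableE R)) => _ [_ [a [b ->] <-]].
rewrite setTI; apply: sub_sigma_algebra; exact/cg/interval_open.
Qed.

Lemma CBL_bound (R : realType) (X : completePMetricType R) (C2 : R)
    (g : X -> R) : CBL C2 g -> exists M, forall x, `|g x| <= M.
Proof.
case=> _ + _; rewrite /supnorm; set S := [set _ | _ in _] => gy.
have ub x : ((`|g x|)%:E <= ereal_sup S)%E by apply: ereal_sup_ubound; exists x.
exists (fine (ereal_sup S)) => x.
rewrite -lee_fin fineK ?ub//.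
by rewrite ge0_fin_numE// (le_trans _ (ub point)) ?lee_fin.
Qed.

Lemma CBL_integrable (R : realType) (X : completePMetricType R) (C2 : R)
    (g : X -> R) d (Om : measurableType d) (P : probability Om R)
    (f : Om -> borel X) :
  CBL C2 g -> measurable_fun setT f ->
  P.-integrable setT (fun w => (g (f w))%:E).
Proof.
move=> Cg mf; have [cg _ _] := Cg; have [M gM] := CBL_bound Cg.
apply: (@measurable_bounded_integrable _ _ _ P (fun w => g (f w))) => //.
- by apply: (le_lt_trans (probability_le1 P measurableT)); rewrite ltry.
- apply: (measurableT_comp _ mf); exact: continuous_borel_measurable.
- exists M; split; first exact: num_real.
  by move=> y My w _ /=; exact: le_trans (gM _) (ltW My).
Qed.

(** * Laws under a measure-preserving flow *)

Section FlowLaw.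
Context (R : realType) (d d' : measure_display) (Om : measurableType d)
  (T : measurableType d') (P : probability Om R) (th : R -> Om -> Om).
Hypothesis flow : metric_flow P th.

Lemma flow_measurable_at (r : R) : measurable_fun setT (th r).
Proof.
exact: (measurableT_comp (flow_measurable flow)
  (@pair2_measurable _ _ Om (measurableTypeR R) r)).
Qed.

(** As theta_r preserves P, the variables f and f o theta_r have the same law,
    so the integral may be transported along either of them.  This freedom of
    r serves twice: r = -t gives the formula for lambda_t(g), and r an almost
    period gives the coupling behind the estimate on rho_1. *)
Lemma integral_law_flow (f : Om -> T) (mf : measurable_fun setT f) (r : R)
    (g : T -> \bar R) :
  measurable_fun setT g ->
  P.-integrable setT (fun w => g (f (th r w))) ->
  (\int[law P mf]_x g x = \int[P]_w g (f (th r w)))%E.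
Proof.
move=> mg ig.
have mfr := measurableT_comp mf (flow_measurable_at r).
transitivity (\int[law P mfr]_x g x)%E.
  apply: eq_measure_integral => A mA _.
  symmetry; apply: (flow_preserving flow).
  by rewrite -[X in measurable X]setTI; exact: mf.
exact: integral_distribution.
Qed.

End FlowLaw.

(** * Evolution of the laws under the transition probabilities *)

Section Evolution.
Context (R : realType) (d : measure_display) (Om : measurableType d)
  (P : probability Om R) (X : completePMetricType R)
  (th : R -> Om -> Om) (Fi : R -> R -> set (set Om)) (Phi : R -> Om -> X -> X)
  (H : R -> Om -> X).
Hypothesis markovPhi : markovian P th Fi Phi.
Hypothesis adaptedH : adapted Fi H.
Hypothesis mH : forall t, measurable_fun setT (H t : Om -> borel X).

(** The Markov property at time s: Fubini's theorem for the independent pair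
    formed by the random map Phi(t, theta_s .) and the point H(s, .).  The
    random map is represented by w itself, viewed in Om with the sigma-algebra
    A over which the map is jointly measurable, so that its joint law with
    H(s, .) lives on a product of two measurable spaces.  Joint measurability
    over A is also what makes the event on the right measurable. *)
Lemma dual_transition_law (t s : R) (B : set (borel X)) :
  0 <= t -> measurable B ->
  measurable [set w | B (Phi t (th s w) (H s w))] /\
  dual_transition P Phi t (law P (mH s)) B =
    P [set w | B (Phi t (th s w) (H s w))].
Proof.
move=> t0 mB.
have flow := filtered_metric_flow (markov_filtered markovPhi).
have [A [sA Am indA mphi]] := markov_map_indep markovPhi s t0.
have mA : (measurable : set (set (g_sigma_algebraType A))) = A.
  exact: measurable_g_measurableTypeE.
have mid : measurable_fun setT (id : Om -> g_sigma_algebraType A).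
  by move=> _ C; rewrite mA setTI => /Am.
pose C := [set p : g_sigma_algebraType A * borel X | B (Phi t (th s p.1) p.2)].
have mC : measurable C by rewrite -[C]setTI; exact: mphi.
split.
  rewrite -[X in measurable X]setTI.
  exact: (measurable_fun_pair mid (mH s) measurableT mC).
have rect D E : measurable D -> measurable E ->
    (P ((id : Om -> g_sigma_algebraType A) @^-1` D `&`
        (H s : Om -> borel X) @^-1` E) =
     P ((id : Om -> g_sigma_algebraType A) @^-1` D) *
       P ((H s : Om -> borel X) @^-1` E))%E.
  by rewrite mA => mD mE; apply: indA => //; exact: adaptedH.
transitivity (\int[law P (mH s)]_y P [set w | C (w, y)])%E; last first.
  by symmetry; exact: (law_pair_indep mid (mH s) rect mC).
apply: eq_integral => x _.
rewrite /transition -(flow_preserving flow s)//.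
apply: (filtration_sub (markov_filtered markovPhi) t0).
exact: (markov_adapted markovPhi x t0).
Qed.

End Evolution.

(** * Estimate of rho_1 by coupling *)

(** Both laws are realised on Om, the second one through f2 o theta_r; the
    difference of the integrals of a test function g is then the integral of
    g(f1) - g(f2 o theta_r), which the Lipschitz bound controls pointwise. *)
Lemma rho1_law_le (R : realType) (d : measure_display) (Om : measurableType d)
    (P : probability Om R) (X : completePMetricType R) (C2 : R)
    (th : R -> Om -> Om) (flow : metric_flow P th) (f1 f2 : Om -> borel X)
    (mf1 : measurable_fun setT f1) (mf2 : measurable_fun setT f2)
    (r delta : R) :
  0 <= C2 -> 0 <= delta ->
  {ae P, forall w, mdist (f1 w : X) (f2 (th r w)) <= delta} ->
  (rho1 C2 (law P mf1) (law P mf2) <= (C2 * delta)%:E)%E.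
Proof.
move=> C20 d0 close; apply: ge_ereal_sup => _ [g [Cg _] <-].
have mf2r := measurableT_comp mf2 (flow_measurable_at flow r).
have i1 := CBL_integrable P Cg mf1.
have i2 := CBL_integrable P Cg mf2r.
have [cg _ lip] := Cg.
have mg := continuous_borel_measurable cg.
have mgE := (measurable_EFinP setT (g : borel X -> R)).2 mg.
rewrite (integral_law_flow flow mf2 mgE i2).
rewrite [X in (X - _)%E]
  (integral_distribution (X := mfun_Sub (mem_set mf1)) mgE i1).
rewrite -integralB//.
apply: le_trans (le_abse_integral _ _ _) _ => //.
  exact: emeasurable_funB (measurable_int _ i1) (measurable_int _ i2).
rewrite -[leRHS]mule1 -(probability_setT P) -integral_cst//.
apply: ae_ge0_le_integral => //.
- apply: measurableT_comp => //.
  exact: emeasurable_funB (measurable_int _ i1) (measurable_int _ i2).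
- by move=> *; rewrite lee_fin mulr_ge0.
apply: filterS close => w fw _ /=.
by rewrite lee_fin (le_trans (lip _ _))// ler_wpM2l.
Qed.

Theorem theorem5p5 (R : realType) (d : measure_display) (Om : measurableType d)
  (P : probability Om R) (X : completePMetricType R) (sepX : separable X)
  (C2 : R) (C2_ge0 : 0 <= C2)
  (th : R -> Om -> Om) (Fi : R -> R -> set (set Om)) (Phi : R -> Om -> X -> X)
  (rdsPhi : random_dynamical_system th Phi)
  (markovPhi : markovian P th Fi Phi)
  (H : R -> Om -> X)
  (solH : random_almost_periodic_solution P th Phi H)
  (adaptedH : adapted Fi H) :
  exists la : R -> probability (borel X) R,
    [/\ almost_periodic_probability_measure P C2 Phi la,
        (forall (t : R) (g : X -> R), CBL C2 g ->
          (\int[la t]_x (g x)%:E = \int[P]_w (g (H t (th (- t)%R w)))%:E)%E) &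
        (forall (t : R) (A : set (borel X)), measurable A ->
          la t A = P [set w | A (H t (th (- t) w))])].
Proof.
have flow := filtered_metric_flow (markov_filtered markovPhi).
have mH := raps_measurable solH.
have mHA t (A : set (borel X)) : measurable A -> measurable (H t @^-1` A).
  by move=> mA; rewrite -[X in measurable X]setTI; exact: mH.
exists (fun t => law P (mH t)); split.
- move=> e e0.
  (* C2 + 1 rather than C2: the bound C2 * delta must be strictly below e,
     and C2 may vanish. *)
  have C2p : 0 < C2 + 1 by rewrite ltr_wpDl.
  have d0 : 0 < e / (C2 + 1) by rewrite divr_gt0.
  have [E rdE aeE] := raps_almost_periodic solH d0.
  exists E => //; split.
    move=> t s B t0 mB.
    have [mPhiB ->] := dual_transition_law markovPhi adaptedH mH s t0 mB.
    apply: (ae_measure_eq mPhiB (mHA _ _ mB)).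
    by apply: filterS aeE => w [evol _] /=; rewrite evol.
  move=> tau s Etau.
  apply: (@le_lt_trans _ _ (C2 * (e / (C2 + 1)))%:E).
    apply: (@rho1_law_le _ _ _ _ _ _ _ flow _ _ _ _ tau) => //; first exact: ltW.
    by apply: filterS aeE => w [_ close]; rewrite addrC ltW ?close.
  by rewrite lte_fin mulrCA gtr_pMr// ltr_pdivrMr// mul1r ltrDl.
- move=> t g Cg; have [cg _ _] := Cg.
  apply: (integral_law_flow flow (mH t)).
    by apply/measurable_EFinP; exact: continuous_borel_measurable.
  apply: (CBL_integrable P Cg).
  exact: measurableT_comp (mH t) (flow_measurable_at flow _).
- by move=> t A mA; symmetry; apply: (flow_preserving flow); exact: mHA.
Qed.
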